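(* Let $C=[\underline{a}_0,h_1,\underline{a}_1,h_2,\underline{a}_2,\dots,h_k,\underline{a}_k,\dots]$ be an $m$-continued fraction of length $\omega$ ($\omega$ a positive integer or $\infty$), with associated $\underline{p}_k\in F[z]^m$, $q_k\in F[z]$ and $n_k$. Then $$Iv\left(\frac{\underline{p}_{k-1}(z)}{q_{k-1}(z)}-\frac{\underline{p}_k(z)}{q_k(z)}\right)=(h_k,n_k)\quad\text{for all } 1\le k<\omega .$$ As a consequence, if $\omega=\infty$, the sequence $\{\underline{p}_k/q_k\}_{k\ge 1}$ is convergent in $F((z^{-1}))^m$.
   Context: Let $F$ be a field, $m\ge 1$ an integer, $Z_m=\{1,\dots,m\}$. $F((z^{-1}))$ is the field of formal Laurent series $\sum_{t\ge i}a_tz^{-t}$ ($i\in\mathbb Z$, $a_t\in F$), with valuation $v(\sum_{t\ge i}a_tz^{-t})=i$ if $a_i\ne 0$, and $v(0)=\infty$. Elements of $F((z^{-1}))^m$ are column vectors; convergence is componentwise with respect to $v$. Order $Z_m\times\mathbb Z$ linearly by $(h,v)<(h',v')$ iff $v<v'$, or $v=v'$ and $h<h'$. For $\underline r=(r_1,\dots,r_m)^\tau\ne\underline 0$ put $v(\underline r)=\min_i v(r_i)$, $I(\underline r)=\min\{i: v(r_i)=v(\underline r)\}$ and $Iv(\underline r)=(I(\underline r),v(\underline r))$ (indexed valuation); $Iv(\underline 0)=(1,\infty)$, which is larger than every element of $Z_m\times\mathbb Z$. An $m$-pre-continued fraction of length $\omega$ ($\omega$ a positive integer or $\infty$) is $C=[\underline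 a_0,h_1,\underline a_1,h_2,\underline a_2,\dots]$ with $\underline a_0=\underline 0$, $h_k\in Z_m$ and $\underline a_k=(a_{k,1},\dots,a_{k,m})^\tau\in F[z]^m$ for $1\le k<\omega$. Let $E_h$ be the matrix obtained from $I_{m+1}$ by exchanging columns $h$ and $m+1$, and $A(\underline a)=\begin{pmatrix} I_m&\underline a\\0&1\end{pmatrix}$. Put $B_0=I_{m+1}$, $B_k=B_{k-1}E_{h_k}A(\underline a_k)$ for $1\le k<\omega$; the last column of $B_k$ is written $\begin{pmatrix}\underline p_k\\ q_k\end{pmatrix}$ with $\underline p_k\in F[z]^m$, $q_k\in F[z]$. (For an $m$-continued fraction all $q_k$ are nonzero, so $\underline p_k/q_k$ makes sense.) Condition 1: $\deg a_{k,h_k}\ge 1$ for $1\le k<\omega$. Under Condition 1 put $t_k=\deg a_{k,h_k}$, $v_{k,j}=\sum_{1\le i\le k,\,h_i=j}t_i$ (so $v_{0,j}=0$), $v_k=v_{k,h_k}$, $d_k=\sum_{1\le i\le k}t_i$ ($d_0=0$), $n_k=d_{k-1}+v_k$, $D_k=\mathrm{Diag}(z^{-v_{k,1}},\dots,z^{-v_{k,m}})$. Condition 2: $(h_k,v_{k-1,h_k})<(h_{k+1},v_{k+1})$ for $1\le k<\omega-1$. Condition 3: $Iv(D_k\underline a_k)=(h_k,v_{k-1,h_k})$ for $1\le k<\omega$. (Convention $\infty-1=\infty$.) An $m$-continued fraction is an $m$-pre-continued fraction satisfying Conditions 1, 2, 3. *)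

(* Defs.v *)
From HB Require Import structures.
From mathcomp Require Import all_boot all_order all_algebra.
From mathcomp Require Import boolp classical_sets fsbigop constructive_ereal.
Set Implicit Arguments.
Unset Strict Implicit.
Unset Printing Implicit Defensive.
Import Order.TTheory GRing.Theory Num.Theory.
Local Open Scope ring_scope.

Definition vanishes_below (F : fieldType) (a : int -> F) (N : int) : Prop :=
  forall t, t < N -> a t = 0.

(* The field F((z^-1)): [a t] is the coefficient of z^(-t), not of z^t. *)
Record laurent (F : fieldType) := Laurent {
  lcoef :> int -> F;
  lcoefP : `[< exists N, vanishes_below lcoef N >]
}.

HB.instance Definition _ (F : fieldType) := [isSub for @lcoef F].
HB.instance Definition _ (F : fieldType) := [Choice of laurent F by <:].

Section LaurentField.
Variable F : fieldType.
Implicit Types (a b c : laurent F) (f g : int -> F) (i n t N : int).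

Lemma laurentP a b : (forall t, a t = b t) -> a = b.
Proof. by move=> eq_ab; apply: val_inj; apply/funext. Qed.

Lemma lbounded a : exists N, vanishes_below a N.
Proof. by apply/asboolP/(lcoefP a). Qed.

Lemma lzero_subproof : `[< exists N, vanishes_below (fun=> 0 : F) N >].
Proof. by apply/asboolP; exists 0. Qed.
Definition lzero := Laurent lzero_subproof.

Lemma lopp_subproof a : `[< exists N, vanishes_below (fun t => - a t) N >].
Proof.
by apply/asboolP; have [N aN] := lbounded a; exists N => t /aN->; rewrite oppr0.
Qed.
Definition lopp a := Laurent (lopp_subproof a).

Lemma ladd_subproof a b : `[< exists N, vanishes_below (fun t => a t + b t) N >].
Proof.
apply/asboolP; have [[N aN] [M bM]] := (lbounded a, lbounded b).
exists (Order.min N M) => t; rewrite lt_min => /andP[/aN-> /bM->].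
exact: addr0.
Qed.
Definition ladd a b := Laurent (ladd_subproof a b).

Lemma laddA : associative ladd.
Proof. by move=> a b c; apply: laurentP => t /=; rewrite addrA. Qed.
Lemma laddC : commutative ladd.
Proof. by move=> a b; apply: laurentP => t /=; rewrite addrC. Qed.
Lemma ladd0 : left_id lzero ladd.
Proof. by move=> a; apply: laurentP => t /=; rewrite add0r. Qed.
Lemma laddN : left_inverse lzero lopp ladd.
Proof. by move=> a; apply: laurentP => t /=; rewrite addNr. Qed.

HB.instance Definition _ :=
  GRing.isZmodule.Build (laurent F) laddA laddC ladd0 laddN.

Lemma lcoef0 t : (0 : laurent F) t = 0. Proof. by []. Qed.
Lemma lcoefD a b t : (a + b) t = a t + b t. Proof. by []. Qed.
Lemma lcoefN a t : (- a) t = - a t. Proof. by []. Qed.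
Lemma lcoefB a b t : (a - b) t = a t - b t. Proof. by []. Qed.

Lemma int_above N t : t < N \/ exists k : nat, t = N + k%:Z.
Proof.
have [|leNt] := ltP t N; [by left | right; exists `|t - N|%N].
by rewrite gez0_abs ?subr_ge0// subrKC.
Qed.

(* Only finitely many terms of the sum below are nonzero. *)
Definition conv f g n : F := \sum_(i \in setT) (f i * g (n - i)).

Lemma conv_lt f g N M n :
  vanishes_below f N -> vanishes_below g M -> n < N + M -> conv f g n = 0.
Proof.
move=> fN gM ltn; apply: fsbig1 => i _.
have [/fN->|leNi] := ltP i N; first by rewrite mul0r.
by rewrite gM ?mulr0// ltrBlDr (lt_le_trans ltn)// addrC lerD2l.
Qed.

Lemma conv_nat f g N M (k : nat) :
  vanishes_below f N -> vanishes_below g M ->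
  conv f g (N + M + k%:Z) =
    \sum_(j < k.+1) f (N + j%:Z) * g (M + (k - j)%N%:Z).
Proof.
move=> fN gM; rewrite /conv.
pose r := [seq N + j%:Z | j <- iota 0 k.+1].
have ur : uniq r.
  by rewrite map_inj_uniq ?iota_uniq// => x y /addrI[].
rewrite -(@fsbig_widen _ _ _ _ [set` r] setT)//; last first.
  move=> i [_ /= /negP iNr].
  have [/fN fi|[j ij]] := int_above N i; first by rewrite fi mul0r.
  rewrite gM ?mulr0//; move: iNr; rewrite ij /r.
  rewrite (mem_map (f := fun j : nat => N + j%:Z)); last by move=> x y /addrI[].
  rewrite mem_iota /=.
  rewrite add0n ltnS -ltnNge => ltkj.
  by rewrite ltrBlDr addrA [M + N]addrC ltrD2l ltz_nat.
rewrite -fsbig_seq// big_map -[iota _ _]/(index_iota 0 k.+1) big_mkord.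
apply: eq_bigr => j _; congr (_ * g _).
by rewrite -subzn ?leq_ord// -[N + M + _]addrA opprD addrACA subrr add0r addrA.
Qed.

Lemma lmul_subproof a b : `[< exists N, vanishes_below (conv a b) N >].
Proof.
apply/asboolP; have [[N aN] [M bM]] := (lbounded a, lbounded b).
by exists (N + M) => t; exact: conv_lt.
Qed.
Definition lmul a b := Laurent (lmul_subproof a b).

Lemma lone_subproof : `[< exists N, vanishes_below (fun t => (t == 0)%:R : F) N >].
Proof. by apply/asboolP; exists 0 => t /lt_eqF->. Qed.
Definition lone := Laurent lone_subproof.

Definition trunc f N (k : nat) : {poly F} := \poly_(j < k) f (N + j%:Z).

Lemma conv_trunc f g N M (k l : nat) :
  vanishes_below f N -> vanishes_below g M -> (k < l)%N ->
  conv f g (N + M + k%:Z) = (trunc f N l * trunc g M l)`_k.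
Proof.
move=> fN gM ltkl; rewrite conv_nat// coefM; apply: eq_bigr => j _.
rewrite !coef_poly (leq_ltn_trans (leq_ord j) ltkl).
by rewrite (leq_ltn_trans (leq_subr _ _) ltkl).
Qed.

Lemma coef_conv_trunc f g N M (k l : nat) :
  vanishes_below f N -> vanishes_below g M -> (k < l)%N ->
  (trunc (conv f g) (N + M) l)`_k = (trunc f N l * trunc g M l)`_k.
Proof. by move=> fN gM ltkl; rewrite coef_poly ltkl; apply: conv_trunc. Qed.

Lemma eq_coefM_le (p p' q q' : {poly F}) (k : nat) :
  (forall j, (j <= k)%N -> p`_j = p'`_j) ->
  (forall j, (j <= k)%N -> q`_j = q'`_j) -> (p * q)`_k = (p' * q')`_k.
Proof.
move=> pp' qq'; rewrite !coefM; apply: eq_bigr => j _.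
by rewrite pp' ?leq_ord// qq'// leq_subr.
Qed.

Lemma lmulC : commutative lmul.
Proof.
move=> a b; apply: laurentP => t /=.
have [[N aN] [M bM]] := (lbounded a, lbounded b).
have [ltt|[k ->]] := int_above (N + M) t.
  by rewrite (conv_lt aN bM ltt) (conv_lt bM aN)// addrC.
by rewrite (@conv_trunc _ _ N M k k.+1)// mulrC -conv_trunc// [M + N]addrC.
Qed.

Lemma lmulA : associative lmul.
Proof.
move=> a b c; apply: laurentP => t /=.
have [[N aN] [M bM] [P cP]] := And3 (lbounded a) (lbounded b) (lbounded c).
have abNM : vanishes_below (conv a b) (N + M) by move=> x; exact: conv_lt.
have bcMP : vanishes_below (conv b c) (M + P) by move=> x; exact: conv_lt.
have [ltt|[k ->]] := int_above (N + M + P) t.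
  by rewrite (conv_lt abNM cP)// (conv_lt aN bcMP)// addrA.
rewrite (conv_trunc abNM cP (ltnSn k)) -[N + M + P]addrA.
rewrite (conv_trunc aN bcMP (ltnSn k)).
transitivity (trunc a N k.+1 * trunc b M k.+1 * trunc c P k.+1)`_k.
  rewrite -mulrA; apply: eq_coefM_le => // j lejk.
  by rewrite coef_conv_trunc.
by apply: eq_coefM_le => // j lejk; rewrite coef_conv_trunc.
Qed.

Lemma lmul1 : left_id lone lmul.
Proof.
move=> a; apply: laurentP => t /=.
have [N aN] := lbounded a.
have oneP : vanishes_below (fun t => (t == 0)%:R : F) 0 by move=> x /lt_eqF->.
have [ltt|[k ->]] := int_above N t.
  by rewrite (conv_lt oneP aN) ?add0r// aN.
rewrite -{1}[N]add0r conv_nat// big_ord_recl /= subn0 mul1r big1 ?addr0// => j _.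
by rewrite mul0r.
Qed.

Lemma lmulDl : left_distributive lmul +%R.
Proof.
move=> a b c; apply: laurentP => t /=.
have [[N aN] [M bM] [P cP]] := And3 (lbounded a) (lbounded b) (lbounded c).
pose L := Order.min N M.
have aL : vanishes_below a L by move=> x; rewrite lt_min => /andP[/aN].
have bL : vanishes_below b L by move=> x; rewrite lt_min => /andP[_ /bM].
have abL : vanishes_below (fun t => a t + b t) L.
  by move=> x ltx; rewrite aL// bL// addr0.
have [ltt|[k ->]] := int_above (L + P) t.
  by rewrite (conv_lt abL cP)// (conv_lt aL cP)// (conv_lt bL cP)// addr0.
rewrite !conv_nat// -big_split; apply: eq_bigr => j _ /=.
by rewrite mulrDl.
Qed.

Lemma lone_neq0 : lone != 0.
Proof.
apply/eqP => /(congr1 (fun a : laurent F => a 0)) /eqP.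
by rewrite /= oner_eq0.
Qed.

HB.instance Definition _ := GRing.Zmodule_isComNzRing.Build (laurent F)
  lmulA lmulC lmul1 lmulDl lone_neq0.

Lemma lcoef1 t : (1 : laurent F) t = (t == 0)%:R. Proof. by []. Qed.

Lemma lcoefM a b n : (a * b) n = \sum_(i \in setT) (a i * b (n - i)).
Proof. by []. Qed.

Lemma laurent_lead a : a != 0 -> exists2 N, a N != 0 & vanishes_below a N.
Proof.
move=> /eqP a0; have [N aN] := lbounded a.
have exk : exists k : nat, a (N + k%:Z) != 0.
  apply: contrapT => nex; apply: a0; apply: laurentP => t.
  have [/aN//|[k ->]] := int_above N t.
  by apply/eqP/negPn/negP => ak; apply: nex; exists k.
case: (ex_minnP exk) => k ak kmin; exists (N + k%:Z) => // t ltt.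
have [/aN//|[j tj]] := int_above N t.
apply/eqP/negPn/negP; rewrite tj => /kmin; apply/negP.
by rewrite -ltnNge -ltz_nat -(ltrD2l N) -tj.
Qed.

Fixpoint inv_prefix (A : nat -> F) (k : nat) : seq F :=
  if k is k'.+1 then
    let s := inv_prefix A k' in
    rcons s ((A 0%N)^-1 *
             ((k' == 0)%:R - \sum_(j < k') A (k' - j)%N * s`_j))
  else [::].

Lemma size_inv_prefix A k : size (inv_prefix A k) = k.
Proof. by elim: k => //= k IHk; rewrite size_rcons IHk. Qed.

Lemma nth_inv_prefix A k j : (j < k)%N ->
  (inv_prefix A k)`_j = (inv_prefix A j.+1)`_j.
Proof.
elim: k => // k IHk; rewrite ltnS leq_eqVlt => /predU1P[->//|ltjk].
by rewrite [LHS]nth_rcons size_inv_prefix ltjk IHk.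
Qed.

Lemma inv_prefixP A k : A 0%N != 0 ->
  \sum_(j < k.+1) (inv_prefix A j.+1)`_j * A (k - j)%N = (k == 0%N)%:R.
Proof.
move=> A0; rewrite big_ord_recr /= subnn nth_rcons size_inv_prefix ltnn eqxx.
rewrite mulrC mulVKf//.
rewrite (eq_bigr (fun j : 'I_k => A (k - j)%N * (inv_prefix A k)`_j)).
  by rewrite addrC subrK.
by move=> j _; rewrite mulrC [in RHS]nth_inv_prefix.
Qed.

Definition linv a : laurent F := xget 0 [set b | b * a = 1].

Lemma linv_ex a : a != 0 -> exists b, b * a = 1.
Proof.
move=> /laurent_lead[N aN altN].
pose A (k : nat) := a (N + k%:Z).
have A0 : A 0%N != 0 by rewrite /A addr0.
pose f t := if t < - N then 0 else (inv_prefix A (absz (t + N)).+1)`_(absz (t + N)).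
have fN : vanishes_below f (- N) by move=> t ltt; rewrite /f ltt.
have fP : `[< exists N, vanishes_below f N >] by apply/asboolP; exists (- N).
exists (Laurent fP); apply: laurentP => t; rewrite lcoef1 [LHS]/=.
have [ltt|[k ->]] := int_above 0 t.
  by rewrite (conv_lt fN altN) ?addNr// (lt_eqF ltt).
rewrite -{1}(addNr N) conv_nat// add0r.
rewrite [RHS](_ : _ = (k == 0%N)%:R)// -(inv_prefixP k A0).
apply: eq_bigr => j _; congr (_ * _).
rewrite /f ltNge lerDl /=.
by rewrite addrAC addNr add0r.
Qed.

Lemma lmulV a : a != 0 -> linv a * a = 1.
Proof. by move=> /linv_ex ex; exact: (xgetPex 0 ex). Qed.

Lemma linv0 : linv 0 = 0.
Proof.
rewrite /linv xgetPN// => b /esym/eqP.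
by rewrite mulr0 oner_eq0.
Qed.

HB.instance Definition _ := GRing.ComNzRing_isField.Build (laurent F) lmulV linv0.

Definition lpoly_coef (p : {poly F}) t : F := if t <= 0 then p`_(`|t|%N) else 0.

Lemma lpoly_subproof p : `[< exists N, vanishes_below (lpoly_coef p) N >].
Proof.
apply/asboolP; exists (- (size p)%:Z) => t ltt; rewrite /lpoly_coef.
case: ifP => // le0; rewrite nth_default//.
by rewrite -lez_nat abszE ler0_norm// lerNr ltW.
Qed.
Definition lpoly (p : {poly F}) : laurent F := Laurent (lpoly_subproof p).

Lemma lpoly_additive : {morph lpoly : p q / p - q}.
Proof.
move=> p q; apply: laurentP => t; rewrite lcoefB /= /lpoly_coef.
by case: ifP => _; rewrite ?coefB ?subr0.
Qed.

Lemma lpoly_multiplicative : (lpoly 1 = 1) * {morph lpoly : p q / p * q}.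
Proof.
split=> [|p q]; apply: laurentP => t.
  rewrite lcoef1 /= /lpoly_coef coef1 absz_eq0.
  by case: ifP => //; case: eqP => // ->.
rewrite lcoefM /= /lpoly_coef; case: ifPn => [le0|]; last first.
  rewrite -ltNge => lt0t; rewrite fsbig1// => i _.
  case: ifPn => [le0|]; last by rewrite mul0r.
  by rewrite ifN ?mulr0// -ltNge subr_gt0 (le_lt_trans le0).
have [k ->] : exists k : nat, t = - k%:Z.
  by exists `|t|%N; rewrite abszE ler0_norm// opprK.
rewrite abszN absz_nat coefM.
pose r := [seq - j%:Z | j <- iota 0 k.+1].
have injN : injective (fun j : nat => - j%:Z) by move=> x y /oppr_inj[].
have ur : uniq r by rewrite map_inj_uniq ?iota_uniq.
rewrite -(@fsbig_widen _ _ _ _ [set` r] setT)//; last first.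
  move=> i [_ /= /negP iNr].
  case: ifPn => [lei0|]; last by rewrite mul0r.
  rewrite ifN ?mulr0//; apply: contra iNr => leki.
  apply/mapP; exists `|i|%N; last by rewrite abszE ler0_norm// opprK.
  rewrite mem_iota add0n /= ltnS -lez_nat abszE ler0_norm//.
  by rewrite -subr_le0 addrC.
rewrite -fsbig_seq// big_map -[iota _ _]/(index_iota 0 k.+1) big_mkord.
apply: eq_bigr => j _.
have lejk : (j <= k)%N by rewrite leq_ord.
have -> : - k%:Z - - j%:Z = - (k - j)%N%:Z.
  by rewrite -subzn// opprB opprK addrC.
by rewrite !abszN !absz_nat !oppr_le0.
Qed.

HB.instance Definition _ :=
  GRing.isZmodMorphism.Build {poly F} (laurent F) lpoly lpoly_additive.
HB.instance Definition _ :=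
  GRing.isMonoidMorphism.Build {poly F} (laurent F) lpoly lpoly_multiplicative.

Definition lval a : \bar int :=
  xget +oo%E [set x | exists i, [/\ x = i%:E, a i != 0 & vanishes_below a i]].

Lemma lval0 : lval 0 = +oo%E.
Proof. by rewrite /lval xgetPN// => x [i [_ /eqP]]. Qed.

Lemma lvalP a i : a i != 0 -> vanishes_below a i -> lval a = i%:E.
Proof.
move=> ai ai0; apply: xget_unique; first by exists i.
move=> _ [j [-> aj aj0]]; case: (ltgtP i j) => [/aj0/eqP|/ai0/eqP|->//].
- by rewrite (negPf ai).
- by rewrite (negPf aj).
Qed.

Definition lconverges (m : nat) (s : nat -> 'cV[laurent F]_m)
    (x : 'cV[laurent F]_m) : Prop :=
  forall (i : 'I_m) (N : int), exists K : nat, forall k, (K <= k)%N ->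
    (N%:E <= lval (s k i ord0 - x i ord0)%R)%E.

End LaurentField.

(* The dimension m >= 1 is written m.+1, and Z_m = {1, ..., m} is 'I_m.+1
   (0-based). *)

Section IndexedValuation.
Variables (F : fieldType) (m : nat).

(* The second component is compared first. *)
Definition iv_lt (x y : 'I_m.+1 * int) : bool :=
  (x.2 < y.2) || ((x.2 == y.2) && (x.1 < y.1)%N).

Definition vval (r : 'cV[laurent F]_m.+1) : \bar int :=
  \big[Order.min/+oo%E]_(i < m.+1) lval (r i ord0).

Definition vind (r : 'cV[laurent F]_m.+1) : 'I_m.+1 :=
  [arg min_(i < ord0 | lval (r i ord0) == vval r) (i : nat)]%N.

(* For r = 0 this gives (ord0, +oo). *)
Definition Iv (r : 'cV[laurent F]_m.+1) : 'I_m.+1 * \bar int :=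
  (vind r, vval r).

Lemma Iv0 : Iv 0 = (ord0, +oo%E).
Proof.
have v0 : vval 0 = +oo%E.
  rewrite /vval (eq_bigr (fun=> +oo%E)) => [|i _]; last by rewrite mxE lval0.
  by rewrite big1_idem // minxx.
rewrite /Iv v0 /vind v0; congr (_, _); case: arg_minnP => [|i _ imin].
  by rewrite mxE lval0.
by apply/val_inj/eqP; rewrite -leqn0; apply: (imin ord0); rewrite mxE lval0.
Qed.

End IndexedValuation.

(* Lengths: [Some n] is the integer n, [None] is infinity. *)
Definition below (k : nat) (w : option nat) : bool :=
  if w is Some n then (k < n)%N else true.

(* [pind k] and [pdig k] are h_k (k >= 1) and a_k (k >= 0); their values outside
   k < plen are irrelevant. *)
Record precf (F : fieldType) (m : nat) := PreCF {
  plen : option nat;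
  pind : nat -> 'I_m.+1;
  pdig : nat -> 'cV[{poly F}]_m.+1;
  plen_gt0 : below 0 plen;
  pdig0 : pdig 0 = 0
}.

Section ContinuedFraction.
Variables (F : fieldType) (m : nat).

Definition Emx (h : 'I_m.+1) : 'M[{poly F}]_(m.+1 + 1) :=
  xcol (lshift 1 h) (rshift m.+1 ord0) 1%:M.

Definition Amx (a : 'cV[{poly F}]_m.+1) : 'M[{poly F}]_(m.+1 + 1) :=
  block_mx 1%:M a 0 1%:M.

Variable C : precf F m.
Let h := pind C.
Let a := pdig C.

Fixpoint Bmx (k : nat) : 'M[{poly F}]_(m.+1 + 1) :=
  if k is k'.+1 then Bmx k' *m Emx (h k'.+1) *m Amx (a k'.+1) else 1%:M.

Definition cf_p (k : nat) : 'cV[{poly F}]_m.+1 := ursubmx (Bmx k).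
Definition cf_q (k : nat) : {poly F} := drsubmx (Bmx k) ord0 ord0.

Definition convergent (k : nat) : 'cV[laurent F]_m.+1 :=
  \col_i (lpoly (cf_p k i ord0) / lpoly (cf_q k)).

(* [(size p).-1] is deg p, with deg 0 = 0. *)
Definition cf_t (k : nat) : nat := (size (a k (h k) ord0)).-1.
Definition cf_vj (k : nat) (j : 'I_m.+1) : nat :=
  (\sum_(1 <= i < k.+1 | h i == j) cf_t i)%N.
Definition cf_v (k : nat) : nat := cf_vj k (h k).
Definition cf_d (k : nat) : nat := (\sum_(1 <= i < k.+1) cf_t i)%N.
Definition cf_n (k : nat) : nat := (cf_d k.-1 + cf_v k)%N.

Definition cf_D (k : nat) : 'M[laurent F]_m.+1 :=
  diag_mx (\row_j (lpoly 'X) ^- cf_vj k j).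

Definition condition1 : Prop :=
  forall k, (1 <= k)%N -> below k (plen C) -> (1 <= cf_t k)%N.

Definition condition2 : Prop :=
  forall k, (1 <= k)%N -> below k (omap predn (plen C)) ->
    iv_lt (h k, (cf_vj k.-1 (h k))%:Z) (h k.+1, (cf_v k.+1)%:Z).

Definition condition3 : Prop :=
  forall k, (1 <= k)%N -> below k (plen C) ->
    Iv (cf_D k *m map_mx (@lpoly F) (a k)) =
      (h k, (cf_vj k.-1 (h k))%:Z%:E).

Definition is_cf : Prop := [/\ condition1, condition2 & condition3].

End ContinuedFraction.

(* Main.v *)
(** Write (P_j; u_j) for the j-th column of B_k, j <= m, and
    w_j = P_j - u_j p_k/q_k.  By induction on k, v(q_k) = -d_k and
    Iv(w_j) = (j, v_{k,j}) for all j.  With h = h_{k+1}, expanding the last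
    column of B_{k+1} gives
      q_{k+1} (p_{k+1}/q_{k+1} - p_k/q_k) = w_h + sum_{j <> h} a_{k+1,j} w_j,
    and Condition 3 says exactly that every term of the sum has indexed
    valuation larger than Iv(w_h) = (h, v_{k,h}); as n_{k+1} = d_{k+1} + v_{k,h},
    this is the claim.  Condition 2 says exactly that (h_k, n_k) is increasing,
    which propagates the induction hypothesis.  Convergence follows from
    n_k >= d_k >= k. *)
Require Import Defs.
From mathcomp Require Import all_boot all_order all_algebra perm zify.
From mathcomp Require Import boolp constructive_ereal.
Import Order.TTheory GRing.Theory Num.Theory.
Local Open Scope ring_scope.

Set Implicit Arguments.
Unset Strict Implicit.

(** * Finite valuations, expressed through coefficients *)

Section Valuation.
Variable F : fieldType.
Implicit Types (a b : laurent F) (N M : int).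

Definition has_val a N : Prop := a N != 0 /\ vanishes_below a N.

Lemma vanishes_belowW a N M : M <= N -> vanishes_below a N -> vanishes_below a M.
Proof. by move=> leMN aN t ltt; apply/aN/(lt_le_trans ltt). Qed.

Lemma vanishes_belowD a b N :
  vanishes_below a N -> vanishes_below b N -> vanishes_below (a + b) N.
Proof. by move=> aN bN t ltt; rewrite lcoefD aN// bN// addr0. Qed.

Lemma vanishes_belowM a b N M :
  vanishes_below a N -> vanishes_below b M -> vanishes_below (a * b) (N + M).
Proof. by move=> aN bM t; exact: conv_lt. Qed.

Lemma lead_coefM a b N M : vanishes_below a N -> vanishes_below b M ->
  (a * b) (N + M) = a N * b M.
Proof.
move=> aN bM; have := conv_nat 0 aN bM.
by rewrite big_ord1 !addr0.
Qed.

Lemma has_val_neq0 a N : has_val a N -> a != 0.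
Proof. by case=> aN _; apply: contraNneq aN => ->. Qed.

Lemma has_valM a b N M : has_val a N -> has_val b M -> has_val (a * b) (N + M).
Proof.
move=> [aN aN0] [bM bM0]; split; last exact: vanishes_belowM.
by rewrite lead_coefM// mulf_neq0.
Qed.

Lemma has_val_unique a N M : has_val a N -> has_val a M -> N = M.
Proof.
move=> [aN aN0] [aM aM0]; case: (ltgtP N M) => // [/aM0|/aN0] /eqP.
  by rewrite (negPf aN).
by rewrite (negPf aM).
Qed.

Lemma has_val1 : has_val 1 0.
Proof. by split=> [|t /lt_eqF]; rewrite lcoef1 ?eqxx ?oner_eq0// => ->. Qed.

(** The inverse has some leading exponent [M], and [a * a^-1 = 1] forces [N + M = 0]. *)
Lemma has_valV a N : has_val a N -> has_val a^-1 (- N).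
Proof.
move=> aN; have a0 := has_val_neq0 aN.
have [M aM aM0] := laurent_lead (invr_neq0 a0).
suff -> : - N = M by [].
have := has_valM aN (conj aM aM0); rewrite divff// => /has_val_unique/(_ has_val1).
lia.
Qed.

Lemma has_val_lpolyXn (n : nat) : has_val (lpoly 'X ^+ n : laurent F) (- n%:Z).
Proof.
elim: n => [|n IHn]; first exact: has_val1.
have -> : - n.+1%:Z = - 1 + - n%:Z by lia.
rewrite exprS; apply: has_valM => //; split=> [|t]; rewrite /= /lpoly_coef.
  by rewrite coefX oner_eq0.
by case: ifP => // le0 ltt; rewrite coefX; case: eqP => //; lia.
Qed.

(** The zero series is no exception: it vanishes below every [N], in accordance with
    [lval 0 = +oo]. *)
Lemma le_lvalP a N : (N%:E <= lval a)%E <-> vanishes_below a N.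
Proof.
have [->|/laurent_lead[M aM aM0]] := eqVneq a 0; first by rewrite lval0 leey.
rewrite (lvalP aM aM0) lee_fin; split=> [leNM|aN].
  exact: vanishes_belowW leNM aM0.
by rewrite leNgt; apply: contra aM => /aN/eqP.
Qed.

Lemma lval_finP a N : lval a = N%:E <-> has_val a N.
Proof.
split=> [|[aN aN0]]; last exact: lvalP.
have [->|/laurent_lead[M aM aM0]] := eqVneq a 0; first by rewrite lval0.
by rewrite (lvalP aM aM0) => -[<-].
Qed.

End Valuation.

(** * The indexed valuation, described componentwise *)

Section IndexedValuation.
Variables (F : fieldType) (m : nat).
Implicit Types (r s : 'cV[laurent F]_m.+1) (h : 'I_m.+1) (n N : int).

(* The bounds [Iv r >= (h, n)] and [Iv r > (h, n)], componentwise. *)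
Definition Iv_ge r h n : Prop :=
  forall i, vanishes_below (r i ord0) (n + (i < h)%N%:Z).
Definition Iv_gt r h n : Prop :=
  forall i, vanishes_below (r i ord0) (n + (i <= h)%N%:Z).
Definition Iv_eq r h n : Prop := Iv_ge r h n /\ r h ord0 n != 0.

(* [arg_minnP] requires the default value [i0] to satisfy [P], which may fail
   for the default [ord0] in [vind]. *)
Lemma arg_minn_witness (I : finType) (i0 i1 : I) (P : pred I) (f : I -> nat) :
  P i1 -> extremum_spec leq P f (arg_min i0 P f).
Proof.
move=> Pi1; suff <- : arg_min i1 P f = arg_min i0 P f by apply: arg_minnP.
rewrite /arg_min /extremum; case: pickP => //= noP.
have [i Pi imin] := arg_minnP f Pi1.
move: (noP i); rewrite /= Pi => /negP[].
by apply/forallP => j; apply/implyP => /imin.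
Qed.

Lemma vval_le r i : (vval r <= lval (r i ord0))%E.
Proof. exact: bigmin_le. Qed.

Lemma IvP r h n : Iv r = (h, n%:E) <-> Iv_eq r h n.
Proof.
split=> [[rh rn]|[rge rh]].
  have rge i : vanishes_below (r i ord0) n.
    by apply/le_lvalP; rewrite -rn vval_le.
  have [k Pk] : exists k, lval (r k ord0) == vval r.
    rewrite /vval (@bigmin_eq_arg _ _ _ _ ord0)// => [|i _]; last exact: leey.
    by eexists; apply: eqxx.
  move: rh; rewrite /vind.
  have [i /eqP ri imin] := @arg_minn_witness _ ord0 k
    (fun i => lval (r i ord0) == vval r) (fun i => i : nat) Pk.
  move=> ih; move: ri imin; rewrite {}ih {i} rn => /lval_finP[rh _] hmin.
  split=> // i; case: ltnP => [ltih|_]; last by rewrite addr0.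
  (* A nonzero coefficient at [n] in a component [i < h] would attain the minimum before [h]; so it
     is 0 and the bound rises to [n + 1]. *)
  have [ri0|ri0] := eqVneq (r i ord0 n) 0; last first.
    have : (h <= i)%N by apply: hmin; apply/eqP/lval_finP.
    by rewrite leqNgt ltih.
  by move=> t ltt; have [->//|tn] := eqVneq t n; apply: rge; lia.
have rhn : has_val (r h ord0) n.
  by split=> //; have := rge h; rewrite ltnn addr0.
have rn : vval r = n%:E.
  apply/eqP; rewrite eq_le -{1}((lval_finP _ _).2 rhn) vval_le /=.
  apply: le_bigmin => [|i _]; first exact: leey.
  by apply/le_lvalP; apply: vanishes_belowW (rge i); lia.
rewrite /Iv rn; congr (_, _); rewrite /vind rn.
have Ph : lval (r h ord0) == n%:E by apply/eqP/lval_finP.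
have [i /eqP/lval_finP[ri _] imin] := @arg_minn_witness _ ord0 h
  (fun i => lval (r i ord0) == n%:E) (fun i => i : nat) Ph.
apply/val_inj/eqP; rewrite eqn_leq imin//= leqNgt; apply: contra ri => ltih.
by rewrite rge// ltih; lia.
Qed.

Lemma Iv_gt_sum (I : finType) (P : pred I) (r : I -> 'cV[laurent F]_m.+1) h n :
  (forall i, P i -> Iv_gt (r i) h n) -> Iv_gt (\sum_(i | P i) r i) h n.
Proof.
move=> rgt; elim/big_ind: _ => [i|s t sgt tgt i|] //; first by rewrite mxE.
by rewrite mxE; apply: vanishes_belowD.
Qed.

Lemma Iv_eqD r s h n : Iv_eq r h n -> Iv_gt s h n -> Iv_eq (r + s) h n.
Proof.
move=> [rge rh] sgt; split=> [i|]; last first.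
  by rewrite mxE lcoefD (sgt h n) ?addr0//; lia.
rewrite mxE; apply: vanishes_belowD (rge i) _.
by apply: vanishes_belowW (sgt i); lia.
Qed.

Lemma Iv_eqN r h n : Iv_eq r h n -> Iv_eq (- r) h n.
Proof.
case=> rge rh; split=> [i t ltt|]; rewrite mxE lcoefN ?oppr_eq0//.
by rewrite rge// oppr0.
Qed.

Lemma Iv_eqZ (c : laurent F) r h n N :
  has_val c N -> Iv_eq r h n -> Iv_eq (c *: r) h (N + n).
Proof.
move=> [cN cN0] [rge rh]; split=> [i|]; rewrite mxE.
  by rewrite -addrA; apply: vanishes_belowM.
rewrite lead_coefM ?mulf_neq0//.
by have := rge h; rewrite ltnn addr0.
Qed.

(** The indexed comparison becomes one integer inequality per component; quantifying over [i : nat]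
    leaves it to [lia]. *)
Lemma Iv_gtZ (c : laurent F) r h n h' n' N :
  vanishes_below c N -> Iv_eq r h n ->
  (forall i : nat, n' + (i <= h')%N%:Z <= N + (n + (i < h)%N%:Z)) ->
  Iv_gt (c *: r) h' n'.
Proof.
move=> cN [rge _] le_n' i; rewrite mxE.
exact: vanishes_belowW (le_n' i) (vanishes_belowM cN (rge i)).
Qed.

End IndexedValuation.

Lemma below_pred k w : below k.+1 w -> below k w.
Proof. by case: w => //= l /ltnW. Qed.

(** * Recursions for the columns of B_k and for the errors w_j *)

Section Convergents.
Variables (F : fieldType) (m : nat) (C : precf F m).
Local Notation h := (pind C).
Local Notation d := (cf_d C).
Local Notation n := (cf_n C).
Local Notation v := (cf_vj C).

Lemma Bmx_EmxE k i j : (Bmx C k *m Emx F (h k.+1)) i j =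
  Bmx C k i (tperm (lshift 1 (h k.+1)) (rshift m.+1 ord0) j).
Proof. by rewrite /Emx xcolE mul1mx -xcolE mxE. Qed.

Lemma mulmx_AmxE m' (X : 'M[{poly F}]_(m', m.+1 + 1)) (a : 'cV_m.+1) :
  X *m Amx a = row_mx (lsubmx X) (lsubmx X *m a + rsubmx X).
Proof.
rewrite -{1}[X]hsubmxK mul_row_block !mulmx1 mulmx0.
by rewrite addr0.
Qed.

(** E_h exchanges column h with the last one, and A(a) alters only the last column. *)
Lemma Bmx_lshift k i (j : 'I_m.+1) : Bmx C k.+1 i (lshift 1 j) =
  if j == h k.+1 then Bmx C k i (rshift m.+1 ord0) else Bmx C k i (lshift 1 j).
Proof.
rewrite [Bmx C k.+1]/= mulmx_AmxE row_mxEl mxE Bmx_EmxE.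
have [->|jh] := eqVneq; first by rewrite tpermL.
by rewrite tpermD ?eq_rlshift// eq_lshift eq_sym.
Qed.

(** The digit at [h k.+1] multiplies the old last column, which E_h moved to place h; the old column
    h enters with coefficient 1. *)
Lemma Bmx_rshift k i : Bmx C k.+1 i (rshift m.+1 ord0) =
  \sum_(j | j != h k.+1) pdig C k.+1 j ord0 * Bmx C k i (lshift 1 j)
  + pdig C k.+1 (h k.+1) ord0 * Bmx C k i (rshift m.+1 ord0)
  + Bmx C k i (lshift 1 (h k.+1)).
Proof.
rewrite [Bmx C k.+1]/= mulmx_AmxE row_mxEr mxE [rsubmx _ _ _]mxE Bmx_EmxE tpermR.
congr (_ + _); rewrite mxE (bigD1 (h k.+1))//= addrC; congr (_ + _).
  apply: eq_bigr => j jh; rewrite mxE Bmx_EmxE mulrC; congr (_ * Bmx C k i _).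
  by rewrite tpermD ?eq_rlshift// eq_lshift eq_sym.
by rewrite mxE Bmx_EmxE tpermL mulrC.
Qed.

Definition cf_dig k j : laurent F := lpoly (pdig C k j ord0).
Definition cf_P k j : 'cV[laurent F]_m.+1 :=
  \col_i lpoly (Bmx C k (lshift 1 i) (lshift 1 j)).
Definition cf_Q k j : laurent F := lpoly (Bmx C k (rshift m.+1 ord0) (lshift 1 j)).
Let p k : 'cV[laurent F]_m.+1 := map_mx (@lpoly F) (cf_p C k).
Let q k : laurent F := lpoly (cf_q C k).

Lemma cf_qE k : cf_q C k = Bmx C k (rshift m.+1 ord0) (rshift m.+1 ord0).
Proof. by rewrite /cf_q !mxE. Qed.

Lemma cf_PS k j : cf_P k.+1 j = if j == h k.+1 then p k else cf_P k j.
Proof.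
by apply/colP => i; rewrite mxE Bmx_lshift; case: ifP; rewrite !mxE.
Qed.

Lemma cf_QS k j : cf_Q k.+1 j = if j == h k.+1 then q k else cf_Q k j.
Proof. by rewrite /cf_Q Bmx_lshift; case: ifP; rewrite // -cf_qE. Qed.

Lemma cf_pE k i : p k i ord0 = lpoly (Bmx C k (lshift 1 i) (rshift m.+1 ord0)).
Proof. by rewrite !mxE. Qed.

Lemma cf_pS k : p k.+1 = \sum_(j | j != h k.+1) cf_dig k.+1 j *: cf_P k j
  + cf_dig k.+1 (h k.+1) *: p k + cf_P k (h k.+1).
Proof.
apply/colP => i; rewrite cf_pE Bmx_rshift !rmorphD rmorphM rmorph_sum /=.
rewrite 2!mxE summxE [(_ *: p k) _ _]mxE cf_pE [cf_P _ _ _ _]mxE.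
by congr (_ + _ + _); apply: eq_bigr => j _; rewrite rmorphM 2!mxE.
Qed.

Lemma cf_qS k : q k.+1 = \sum_(j | j != h k.+1) cf_dig k.+1 j * cf_Q k j
  + cf_dig k.+1 (h k.+1) * q k + cf_Q k (h k.+1).
Proof.
rewrite /q !cf_qE Bmx_rshift !rmorphD rmorphM rmorph_sum /=.
by congr (_ + _ + _); apply: eq_bigr => j _; rewrite rmorphM.
Qed.

Lemma scale_convergent k : q k != 0 -> q k *: convergent C k = p k.
Proof. by move=> q0; apply/colP => i; rewrite !mxE mulrC divfK. Qed.

(* The vector w_j above, with P_j = [cf_P k j] and u_j = [cf_Q k j]. *)
Definition cf_err k j : 'cV[laurent F]_m.+1 :=
  cf_P k j - cf_Q k j *: convergent C k.

(** After expanding p_{k+1} and q_{k+1}, the two contributions of the digit at [h k.+1] cancel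
    because q_k (p_k/q_k) = p_k; only the w_j remain. *)
Lemma scale_convergentB k : q k != 0 -> q k.+1 != 0 ->
  q k.+1 *: (convergent C k - convergent C k.+1) =
  - (cf_err k (h k.+1) + \sum_(j | j != h k.+1) cf_dig k.+1 j *: cf_err k j).
Proof.
move=> q0 q1; rewrite scalerBr (scale_convergent q1) cf_pS cf_qS -opprB.
have -> : \sum_(j | j != h k.+1) cf_dig k.+1 j *: cf_err k j =
    \sum_(j | j != h k.+1) cf_dig k.+1 j *: cf_P k j -
    (\sum_(j | j != h k.+1) cf_dig k.+1 j * cf_Q k j) *: convergent C k.
  rewrite scaler_suml -sumrB; apply: eq_bigr => j _.
  by rewrite /cf_err scalerBr scalerA.
rewrite !scalerDl -scalerA (scale_convergent q0) /cf_err; congr (- _).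
set X := _ *: p k; rewrite (addrAC _ X) (addrAC _ X _ : _ + X + _ *: _ = _).
rewrite opprD addrACA subrr addr0.
by rewrite [RHS]addrC opprD addrACA.
Qed.

(** The new column h is (p_k; q_k); the other columns stay, so only the subtracted convergent
    changes. *)
Lemma cf_errS k j : q k != 0 -> cf_err k.+1 j =
  if j == h k.+1 then q k *: (convergent C k - convergent C k.+1)
  else cf_err k j + cf_Q k j *: (convergent C k - convergent C k.+1).
Proof.
move=> q0; rewrite /cf_err cf_PS cf_QS; case: ifP => _.
  by rewrite -(scale_convergent q0) scalerBr.
by rewrite scalerBr addrA subrK.
Qed.

(** * The integers d_k, v_{k,j}, n_k and the valuations of the digits *)

Lemma cf_dS k : d k.+1 = (d k + cf_t C k.+1)%N.
Proof. by rewrite /cf_d big_nat_recr. Qed.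

Lemma cf_vjS k j : v k.+1 j = (v k j + (h k.+1 == j) * cf_t C k.+1)%N.
Proof.
rewrite /cf_vj big_mkcond [in RHS]big_mkcond big_nat_recr//=.
by congr (_ + _)%N; case: ifP; rewrite ?mul1n.
Qed.

(** Moving t_{k+1} from v to d exposes v_{k,h}, the valuation appearing in Condition 3. *)
Lemma cf_nS k : n k.+1 = (d k.+1 + v k (h k.+1))%N.
Proof. by rewrite /cf_n /= /cf_v cf_dS cf_vjS eqxx; lia. Qed.

Hypothesis cfC : is_cf C.

Lemma cf_t_gt0 k : below k.+1 (plen C) -> (0 < cf_t C k.+1)%N.
Proof. by case: cfC => c1 _ _; apply: c1. Qed.

(* [(h k, n k)] is increasing; the junk value [h 0] is harmless since
   [n 0 = 0 < n 1]. *)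
Lemma cf_n_lt k : below k.+1 (plen C) ->
  (n k < n k.+1)%N \/ n k = n k.+1 /\ (h k < h k.+1)%N.
Proof.
case: k => [|k] bk.
  left; rewrite cf_nS cf_dS /cf_n /= /cf_v /cf_d /cf_vj !big_geq//.
  by have := cf_t_gt0 bk; lia.
have {}bk : below k.+1 (omap predn (plen C)).
  by move: bk; case: (plen C) => //= w; lia.
have [_ c2 _] := cfC; move: (c2 k.+1 isT bk); rewrite /iv_lt /= => lt_hv.
rewrite /cf_n /= cf_dS /cf_v (cf_vjS k) eqxx.
by move: lt_hv; rewrite /cf_v; lia.
Qed.

Lemma cf_D_digE k j : (cf_D C k *m map_mx (@lpoly F) (pdig C k)) j ord0 =
  (lpoly 'X) ^- v k j * cf_dig k j.
Proof. by rewrite /cf_D mul_diag_mx !mxE. Qed.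

(** The lower bound in Condition 3, with D_{k+1} undone by multiplying by z^{v_{k+1,j}}. *)
Lemma cf_dig_above k j : below k.+1 (plen C) ->
  vanishes_below (cf_dig k.+1 j)
    ((v k (h k.+1))%:Z + (j < h k.+1)%N%:Z - (v k.+1 j)%:Z).
Proof.
move=> bk; case: cfC => _ _ /(_ k.+1 isT bk)/IvP[/(_ j) + _].
rewrite cf_D_digE => ge_j; have [_ Xv] := has_val_lpolyXn F (v k.+1 j).
have := vanishes_belowM Xv ge_j; rewrite mulVKf; last first.
  exact: has_val_neq0 (has_val_lpolyXn F _).
by rewrite addrC.
Qed.

Lemma cf_dig_val k : below k.+1 (plen C) ->
  has_val (cf_dig k.+1 (h k.+1)) (- (cf_t C k.+1)%:Z).
Proof.
move=> bk; case: cfC => _ _ /(_ k.+1 isT bk)/IvP[/(_ (h k.+1)) + +].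
rewrite cf_D_digE ltnn addr0 => ge_h hd.
have Xv := has_val_lpolyXn F (v k.+1 (h k.+1)).
have := has_valM Xv (conj hd ge_h); rewrite mulVKf ?(has_val_neq0 Xv)//.
by rewrite cf_vjS eqxx /=; congr has_val; lia.
Qed.

(* The third clause is what keeps both [q k.+1] of degree [d k.+1] and [Iv] of
   the errors unchanged at the next step: a nonzero [cf_Q k j] is [q l.-1] for
   the last [l <= k] with [h l = j], its valuation is [v l - n l], and
   [(h l, n l) <= (h k, n k)]. *)
Definition cf_inv k : Prop :=
  [/\ has_val (q k) (- (d k)%:Z),
      forall j, Iv_eq (cf_err k j) j (v k j)%:Z,
      forall j, vanishes_below (cf_Q k j)
                  ((v k j)%:Z - (n k)%:Z + (h k < j)%N%:Z)
    & forall j, vanishes_below (cf_Q k j) (1 - (d k)%:Z)].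

(** * The induction on k: first B_0 = I, where w_j is the j-th unit vector, then the step *)

Lemma cf_inv0 : cf_inv 0.
Proof.
have Q0 j : cf_Q 0 j = 0.
  by rewrite /cf_Q /= mxE eq_rlshift mulr0n rmorph0.
have d0 : d 0 = 0%N by rewrite /cf_d big_geq.
have v0 j : v 0 j = 0%N by rewrite /cf_vj big_geq.
split=> [|j|j|j]; try by rewrite Q0.
  by rewrite /q cf_qE /= mxE eqxx rmorph1 d0; apply: has_val1.
have P0 i : cf_P 0 j i ord0 = (i == j)%:R.
  by rewrite mxE /= mxE eq_lshift; case: eqP; rewrite (rmorph1, rmorph0).
rewrite /cf_err Q0 scale0r subr0 v0; split=> [i|]; rewrite P0.
  have [->|_] := eqVneq; last by [].
  by rewrite ltnn addr0; case: (has_val1 F).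
by rewrite eqxx; case: (has_val1 F).
Qed.

(** The product a_{k+1,h} q_k has valuation -t_{k+1} - d_k = -d_{k+1} and dominates every other term
    of q_{k+1}. *)
Lemma cf_q_step k : below k.+1 (plen C) -> cf_inv k ->
  has_val (q k.+1) (- (d k.+1)%:Z).
Proof.
move=> bk [qk _ Qn Qd]; have t0 := cf_t_gt0 bk.
have [lead above] := has_valM (cf_dig_val bk) qk.
have low : vanishes_below (\sum_(j | j != h k.+1) cf_dig k.+1 j * cf_Q k j
    + cf_Q k (h k.+1)) (1 - (d k.+1)%:Z).
  apply: vanishes_belowD; last by apply: vanishes_belowW (Qd _); rewrite cf_dS; lia.
  elim/big_ind: _ => [||j jh]; [by [] | by move=> *; apply: vanishes_belowD |].
  (* What is needed is 1 <= n_{k+1} - n_k + [j < h_{k+1}] + [h_k < j]. If n_k = n_{k+1}, then h_k <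
     h_{k+1}, and j <> h_{k+1} makes a bracket equal to 1. *)
  apply: vanishes_belowW (vanishes_belowM (cf_dig_above bk) (Qn j)).
  have := cf_n_lt bk; rewrite cf_nS (cf_vjS k j) eq_sym (negPf jh) mul0n addn0.
  by move: jh; rewrite -val_eqE /=; lia.
have dE : - (d k.+1)%:Z = - (cf_t C k.+1)%:Z + - (d k)%:Z by rewrite cf_dS; lia.
rewrite cf_qS addrAC addrC; split; last first.
  by apply: vanishes_belowD; [rewrite dE | apply: vanishes_belowW low; lia].
by rewrite lcoefD [X in _ + X]low ?addr0 ?dE//; lia.
Qed.

Lemma Iv_convergentB k : below k.+1 (plen C) -> cf_inv k ->
  Iv_eq (convergent C k - convergent C k.+1) (h k.+1) (n k.+1)%:Z.
Proof.
move=> bk invk; have qk1 := cf_q_step bk invk; case: invk => qk err _ _.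
have q0 := has_val_neq0 qk; have q1 := has_val_neq0 qk1.
rewrite -[_ - _](scalerK q1) (scale_convergentB q0 q1).
have -> : (n k.+1)%:Z = - - (d k.+1)%:Z + (v k (h k.+1))%:Z by rewrite cf_nS; lia.
apply: Iv_eqZ (has_valV qk1) _; apply/Iv_eqN/Iv_eqD; first exact: err.
(* The inequality left is [i <= h] <= [j < h] + [i < j], true since j <> h. *)
apply: Iv_gt_sum => j jh; apply: Iv_gtZ (cf_dig_above bk) (err j) _ => i.
rewrite cf_vjS eq_sym (negPf jh) mul0n addn0.
by move: jh; rewrite -val_eqE /=; lia.
Qed.

Lemma cf_invS k : below k.+1 (plen C) -> cf_inv k -> cf_inv k.+1.
Proof.
move=> bk invk; have qk1 := cf_q_step bk invk; have Ivk := Iv_convergentB bk invk.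
case: invk => qk err Qn Qd; have lt_n := cf_n_lt bk; have t0 := cf_t_gt0 bk.
have vE j : j != h k.+1 -> v k.+1 j = v k j.
  by move=> jh; rewrite cf_vjS eq_sym (negPf jh) mul0n addn0.
split=> // j; rewrite ?cf_QS ?(cf_errS _ (has_val_neq0 qk)).
- have [->|jh] := eqVneq.
    have -> : (v k.+1 (h k.+1))%:Z = - (d k)%:Z + (n k.+1)%:Z.
      by rewrite cf_nS cf_dS cf_vjS eqxx; lia.
    exact: Iv_eqZ.
  (* Needed: [i <= j] <= n_{k+1} - n_k + [h_k < j] + [i < h_{k+1}]. If n_k = n_{k+1} and i <= j <=
     h_k, then i < h_{k+1}. *)
  rewrite vE//; apply: Iv_eqD => //; apply: Iv_gtZ (Qn j) Ivk _ => i.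
  by move: jh; rewrite -val_eqE /=; lia.
- have [->|jh] := eqVneq.
    (* Here the bound is an equality, because n_{k+1} = d_k + v_{k+1,h}. *)
    apply: vanishes_belowW qk.2; rewrite ltnn cf_nS cf_dS cf_vjS eqxx; lia.
  apply: vanishes_belowW (Qn j); rewrite vE//.
  by move: jh; rewrite -val_eqE /=; lia.
- case: ifP => _; [apply: vanishes_belowW qk.2|apply: vanishes_belowW (Qd j)].
    by rewrite cf_dS; lia.
  by rewrite cf_dS; lia.
Qed.

Lemma cf_invP k : below k (plen C) -> cf_inv k.
Proof.
elim: k => [|k IHk] bk; first exact: cf_inv0.
by apply: cf_invS => //; apply/IHk/below_pred.
Qed.

Lemma leq_cf_d k : below k (plen C) -> (k <= d k)%N.
Proof.
elim: k => // k IHk bk; rewrite cf_dS.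
by have := cf_t_gt0 bk; have := IHk (below_pred bk); lia.
Qed.

End Convergents.

(** * Completeness of F((z^-1)) and of its column spaces *)

Section Completeness.
Variable F : fieldType.

Lemma laurent_complete (s : nat -> laurent F) :
  (forall k, vanishes_below (s k - s k.+1) k%:Z) ->
  exists x : laurent F, forall k, vanishes_below (s k - x) k%:Z.
Proof.
move=> sC.
have sE (k j : nat) t : t < k%:Z -> s k t = s (k + j)%N t.
  move=> ltt; elim: j => [|j ->]; first by rewrite addn0.
  by apply/eqP; rewrite -subr_eq0 -lcoefB addnS sC//; lia.
(* The coefficient at [t] is stationary from any index exceeding [t], and [|t| + 1] is one. *)
pose f t := s `|t|%N.+1 t.
have fE (k : nat) t : t < k%:Z -> s k t = f t.
  by move=> ltt; rewrite /f (sE _ `|t|%N.+1)// addnC -sE//; lia.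
have fP : `[< exists N, vanishes_below f N >].
  (* At negative exponents the limit already agrees with [s 0], which bounds it below. *)
  apply/asboolP; have [N s0] := lbounded (s 0%N); exists (Order.min N 0) => t.
  by rewrite lt_min => /andP[ltN lt0]; rewrite -(fE 0%N)// s0.
by exists (Laurent fP) => k t ltt; rewrite lcoefB (fE _ _ ltt) subrr.
Qed.

Lemma laurent_cV_complete m (s : nat -> 'cV[laurent F]_m) :
  (forall k i, vanishes_below ((s k - s k.+1) i ord0) k%:Z) ->
  exists x, lconverges s x.
Proof.
move=> sC.
have /choice[x xP] i : exists x : laurent F,
    forall k, vanishes_below (s k i ord0 - x) k%:Z.
  by apply: laurent_complete => k; move: (sC k i); rewrite !mxE.
exists (\col_i x i) => i N; exists `|N|%N => k leNk.
by apply/le_lvalP; rewrite mxE; apply: vanishes_belowW (xP i k); lia.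
Qed.

End Completeness.

Theorem theorem6p2 (F : fieldType) (m : nat) (C : precf F m) :
  is_cf C ->
  (forall k : nat, (1 <= k)%N -> below k (plen C) ->
     Iv (convergent C k.-1 - convergent C k)
     = (pind C k, ((cf_n C k)%:Z)%:E))
  /\
  (plen C = None ->
     exists x : 'cV[laurent F]_m.+1,
       lconverges (fun k => convergent C k.+1) x).
Proof.
move=> cfC.
have stepIv k : below k.+1 (plen C) ->
    Iv_eq (convergent C k - convergent C k.+1) (pind C k.+1) (cf_n C k.+1)%:Z.
  by move=> bk; apply/Iv_convergentB/cf_invP/below_pred.
split=> [[//|k] _ /stepIv/IvP//|Cinf].
have bk k : below k (plen C) by rewrite Cinf.
(* The sequence starts at index 1, so its k-th difference has bound n_{k+2} >= d_{k+2} >= k + 2. *)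
apply: laurent_cV_complete => k i; have [/(_ i) kn _] := stepIv _ (bk k.+2).
apply: vanishes_belowW kn; have := leq_cf_d cfC (bk k.+2).
by rewrite cf_nS; lia.
Qed.
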